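(* Let $q$ be a power of a prime $p$, let $0\le j\le q-2$ and $n\ge1$ be integers, and put $k=2j+2+(n-1)(q-1)$, $m\equiv j+1\pmod{q-1}$ and $r=\dim_{\mathbb{C}_\infty}S^1_{k,m}(GL_2(\mathbb{F}_q[t]))$. If $\alpha\in\mathbb{Q}$ is a slope for the Atkin operator $\mathbf{U}_t$ on $S^1_{k,m}(\Gamma_0(t))$ of multiplicity $d(\alpha,k)\ge1$, then $$\alpha\le j+1+[(n-r)n-1](q-1).$$
   Context: $K_\infty$ is the completion of $\mathbb{F}_q(t)$ at $\infty=1/t$, $\mathbb{C}_\infty$ is the completion of an algebraic closure of $K_\infty$, $\Omega=\mathbb{P}^1(\mathbb{C}_\infty)-\mathbb{P}^1(K_\infty)$. $\Gamma_0(t)=\{\begin{pmatrix}a&b\\c&d\end{pmatrix}\in GL_2(\mathbb{F}_q[t]):c\equiv0\bmod t\}$. For $\Gamma=GL_2(\mathbb{F}_q[t])$ or $\Gamma_0(t)$, $S^1_{k,m}(\Gamma)$ is the space of Drinfeld cusp forms of weight $k$ and type $m$: rigid analytic $\varphi:\Omega\to\mathbb{C}_\infty$ with $\varphi(\gamma z)(\det\gamma)^m(cz+d)^{-k}=\varphi(z)$ for all $\gamma=\begin{pmatrix}a&b\\c&d\end{pmatrix}\in\Gamma$, holomorphic and vanishing at all cusps. $\mathbf{U}_t(\varphi)(z)=\sum_{b\in\mathbb{F}_q}\varphi\left(\frac{z+b}{t}\right)$ on $S^1_{k,m}(\Gamma_0(t))$. It is known that $r=\dim_{\mathbb{C}_\infty}\mathrm{Ker}(\mathbf{U}_t)$.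 For $k,j,n,m$ as in the claim, $S^1_{k,m}(\Gamma_0(t))$ has dimension $n$ and in a suitable basis (of harmonic cocycles) $\mathbf{U}_t$ has matrix $MD$, where $M=(m_{a,b})_{1\le a,b\le n}$ has entries in $\mathbb{F}_p$, $m_{a,b}=-\left[\binom{j+(n-a)(q-1)}{j+(n-b)(q-1)}+(-1)^{j+1}\binom{j+(n-a)(q-1)}{j+(b-1)(q-1)}\right]$ if $a\ne b$, $m_{a,a}=(-1)^j\binom{j+(n-a)(q-1)}{j+(a-1)(q-1)}$ (with $\binom{x}{y}=0$ if $y>x$), and $D=\mathrm{diag}(t^{s_1},\dots,t^{s_n})$ with $s_i=j+1+(i-1)(q-1)$. Slopes: the characteristic polynomial $P_{\mathbf{U}_t}(X)$ of $\mathbf{U}_t$ on $S^1_{k,m}(\Gamma_0(t))$ has coefficients in $\mathbb{F}_q[t]$; let $v_t$ be the $t$-adic valuation ($v_t(t)=1$), extended to an algebraic closure of $\mathbb{F}_q((t))$. For $\alpha\in\mathbb{Q}$, $d(\alpha,k)$ is the number of roots of $P_{\mathbf{U}_t}(X)$, counted with multiplicity, of $t$-adic valuation $\alpha$; $\alpha$ is a slope (of multiplicity $d(\alpha,k)$) if $d(\alpha,k)\ge1$. The root $0$ does not contribute a slope. *)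

(* Defs.v *)
From HB Require Import structures.
From mathcomp Require Import all_boot all_order all_algebra.
From mathcomp Require Import all_classical all_reals all_analysis.
Set Implicit Arguments.
Unset Strict Implicit.
Unset Printing Implicit Defensive.
Import Order.TTheory GRing.Theory Num.Theory.
Import numFieldNormedType.Exports.
Local Open Scope classical_set_scope.
Local Open Scope ring_scope.

(* Throughout, F is the finite field F_q (so q = #|F|), A = {poly F} is F_q[t],
   and t is the indeterminate 'X. *)

(* F_q(t) inside a field K, for an embedding iota of F_q[t] into K. *)
Definition ratfun (F : finFieldType) (K : fieldType)
    (iota : {rmorphism {poly F} -> K}) : set K :=
  [set x | exists a b : {poly F}, b != 0 /\ x = iota a / iota b].

Definition algebraic_over (K : fieldType) (S : set K) (x : K) : Prop :=
  exists P : {poly K}, [/\ P != 0, forall i, S P`_i & root P x].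

(* ------------------------------------------------------------------------ *)
(* C_oo is handled up to isometric isomorphism.                             *)
(* ------------------------------------------------------------------------ *)
Section Infinity.
Variables (R : realType) (F : finFieldType) (C : closedFieldType).
Variables (iota : {rmorphism {poly F} -> C}) (abs : C -> R).

Definition nonarch_abs : Prop :=
  [/\ forall x, 0 <= abs x,
      forall x, abs x = 0 <-> x = 0,
      forall x y, abs (x * y) = abs x * abs y
    & forall x y, abs (x + y) <= Num.max (abs x) (abs y)].

Definition abs_cvg (u : nat -> C) (l : C) : Prop :=
  (fun n => abs (u n - l)) @ \oo --> (0 : R).

Definition abs_cauchy (u : nat -> C) : Prop :=
  forall eps : R, 0 < eps ->
    exists N, forall a b, (N <= a)%N -> (N <= b)%N -> abs (u a - u b) < eps.

(* As C is complete, the closure of F_q(t) in C is its completion. *)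
Definition Kinfty : set C :=
  [set x | forall eps : R, 0 < eps -> exists2 y, ratfun iota y & abs (x - y) < eps].

(* C, with the absolute value normalised by |t| = q, is the completion of an
   algebraic closure of K_oo: it is complete, and the algebraic closure of K_oo
   inside the algebraically closed field C is dense. *)
Definition is_Cinfty : Prop :=
  [/\ nonarch_abs,
      forall f : {poly F}, f != 0 -> abs (iota f) = #|F|%:R ^+ (size f).-1,
      forall u, abs_cauchy u -> exists l, abs_cvg u l
    & forall (x : C) (eps : R), 0 < eps ->
        exists2 y, algebraic_over Kinfty y & abs (x - y) < eps].

Definition Omega : set C := ~` Kinfty.

(* The affinoids |z| <= q^n, |z - x| >= q^-n for all x in K_oo, whose union is
   the standard admissible covering of Omega. *)
Definition Omega_aff (n : nat) : set C :=
  [set z | abs z <= #|F|%:R ^+ n /\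
           forall x, Kinfty x -> #|F|%:R ^- n <= abs (z - x)].

(* Rigid analytic on Omega: on each affinoid of the covering, a uniform limit of
   rational functions without poles there. *)
Definition rigid_analytic (phi : C -> C^o) : Prop :=
  forall (n : nat) (eps : R), 0 < eps ->
    exists a b : {poly C}, forall z, Omega_aff n z ->
      b.[z] != 0 /\ abs (phi z - a.[z] / b.[z]) < eps.

Definition GL2A : set 'M[{poly F}]_2 := [set g | g \in unitmx].

Definition Gamma0t : set 'M[{poly F}]_2 :=
  [set g | g \in unitmx /\ 'X %| g 1 0].

Definition slash (k : nat) (m : int) (phi : C -> C^o) (g : 'M[{poly F}]_2) :
    C -> C^o := fun z =>
  let den := iota (g 1 0) * z + iota (g 1 1) in
  phi ((iota (g 0 0) * z + iota (g 0 1)) / den) * iota (\det g) ^ m * den ^- k.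

(* The b in A such that z |-> z + b belongs to g^-1 Gamma g. *)
Definition periods (Gamma : set 'M[{poly F}]_2) (g : 'M[{poly F}]_2) :
    set {poly F} :=
  [set b | Gamma (g *m (1%:M + b *: delta_mx 0 1) *m invmx g)].

(* w = e_L(z), where e_L(z) = z \prod_(0 != l in L) (1 - z / l) is the Carlitz
   exponential of the lattice L, the product being ordered by degree; rVpoly
   enumerates the polynomials of degree < d. *)
Definition lattice_exp (L : set {poly F}) (z w : C) : Prop :=
  abs_cvg (fun d : nat =>
    z * \prod_(c : 'rV[F]_d | (rVpoly c != 0) && `[< L (rVpoly c) >])
          (1 - z / iota (rVpoly c))) w.

(* phi is holomorphic and vanishes at the cusp g(oo): phi | g is given near oo,
   i.e. where the distance of z to K_oo is large, by a convergent power series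
   without constant term in the local parameter 1 / e_L(z). *)
Definition vanishes_at_cusp (Gamma : set 'M[{poly F}]_2) (k : nat) (m : int)
    (phi : C -> C^o) (g : 'M[{poly F}]_2) : Prop :=
  exists (a : nat -> C) (rho : R), a 0%N = 0 /\
    forall z, Omega z -> (forall x, Kinfty x -> rho <= abs (z - x)) ->
      exists2 w, lattice_exp (periods Gamma g) z w &
        abs_cvg (fun N => \sum_(i < N) a i * w^-1 ^+ i) (slash k m phi g z).

(* S^1_{k,m}(Gamma). A function on Omega is encoded by its extension by 0 to C.
   All cusps are of the form g(oo) with g in GL_2(A), since A is principal. *)
Definition cusp_forms (k : nat) (m : int) (Gamma : set 'M[{poly F}]_2) :
    set (C -> C^o) :=
  [set phi | [/\ forall z, ~ Omega z -> phi z = 0,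
                 rigid_analytic phi,
                 forall g, Gamma g -> forall z, Omega z ->
                   slash k m phi g z = phi z
               & forall g, GL2A g -> vanishes_at_cusp Gamma k m phi g]].

Definition Ut (phi : C -> C^o) : C -> C^o :=
  fun z => \sum_(b : F) phi ((z + iota b%:P) / iota 'X).

End Infinity.

(* ------------------------------------------------------------------------ *)
(* Linear algebra in a finite-dimensional subspace S of a vector space V.   *)
(* ------------------------------------------------------------------------ *)
Section LinearAlgebra.
Variables (K : fieldType) (V : lmodType K).

Definition is_basis (S : set V) (n : nat) (e : 'I_n -> V) : Prop :=
  (forall v, S v <-> exists c : 'I_n -> K, v = \sum_i c i *: e i) /\
  (forall c : 'I_n -> K, \sum_i c i *: e i = 0 -> forall i, c i = 0).

Definition has_dim (S : set V) (n : nat) : Prop :=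
  exists e : 'I_n -> V, is_basis S e.

(* The columns of A are the coordinates of the images of the basis vectors. *)
Definition has_matrix (T : V -> V) (n : nat) (e : 'I_n -> V) (A : 'M[K]_n) : Prop :=
  forall b, T (e b) = \sum_a A a b *: e a.

Definition is_char_poly (S : set V) (T : V -> V) (P : {poly K}) : Prop :=
  exists (n : nat) (e : 'I_n -> V) (A : 'M[K]_n),
    [/\ is_basis S e, has_matrix T e A & P = char_poly A].

End LinearAlgebra.

(* The matrices M and D; ordinals start at 0, so that the 1-based row index is
   a.+1 and the column index is b.+1. *)
Definition Mmx (F : finFieldType) (j n : nat) : 'M[F]_n :=
  let q := #|F| in
  \matrix_(a, b)
    if a == b
    then (-1) ^+ j * 'C(j + (n - a.+1) * (q - 1), j + a * (q - 1))%:R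
    else - ('C(j + (n - a.+1) * (q - 1), j + (n - b.+1) * (q - 1))%:R
            + (-1) ^+ j.+1
              * 'C(j + (n - a.+1) * (q - 1), j + b * (q - 1))%:R).

Definition Dmx (F : finFieldType) (j n : nat) : 'M[{poly F}]_n :=
  diag_mx (\row_(i < n) 'X^(j.+1 + i * (#|F| - 1))).

Definition MDmx (F : finFieldType) (j n : nat) : 'M[{poly F}]_n :=
  map_mx polyC (Mmx F j n) *m Dmx F j n.

(* ------------------------------------------------------------------------ *)
(* The algebraic closure of F_q((t)), with its t-adic valuation, is handled *)
(* up to isomorphism.                                                       *)
(* ------------------------------------------------------------------------ *)
Section Slopes.
Variables (F : finFieldType) (L : closedFieldType).
Variables (iota : {rmorphism {poly F} -> L}) (v : L -> \bar rat).

Definition val_cvg (u : nat -> L) (l : L) : Prop :=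
  forall N : nat, exists n0, forall n, (n0 <= n)%N -> (N%:R%:E <= v (u n - l))%E.

Definition val_cauchy (u : nat -> L) : Prop :=
  forall N : nat, exists n0, forall a b, (n0 <= a)%N -> (n0 <= b)%N ->
    (N%:R%:E <= v (u a - u b))%E.

(* F_q((t)): the closure of F_q(t) in L. *)
Definition Laurent : set L :=
  [set x | forall N : nat, exists2 y, ratfun iota y & (N%:R%:E <= v (x - y))%E].

(* v extends the t-adic valuation of F_q[t] (mup 0 f is the order of f at t = 0),
   the closure of F_q(t) in L is complete, and L is algebraic over it. *)
Definition is_Laurent_closure : Prop :=
  [/\ [/\ forall x, v x = +oo%E <-> x = 0,
          forall x y, v (x * y) = (v x + v y)%E
        & forall x y, (Order.min (v x) (v y) <= v (x + y))%E],
      forall f : {poly F}, f != 0 -> v (iota f) = (mup 0 f)%:R%:E,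
      forall u, (forall n, Laurent (u n)) -> val_cauchy u ->
        exists l, val_cvg u l
    & forall x, algebraic_over Laurent x].

(* d(alpha): the number of roots in L of P, with multiplicity, that have
   valuation alpha. The root 0 has valuation +oo and never counts. *)
Definition slope_mult (P : {poly {poly F}}) (alpha : rat) : nat :=
  count (fun x => v x == alpha%:E)
    (sval (closed_field_poly_normal (map_poly iota P))).

End Slopes.

(* Main.v *)
(* The characteristic polynomial of U_t is that of MD. All entries of MD are
   divisible by t^lo and have degree at most hi, where lo = j + 1 and
   hi = j + 1 + (n - 1)(q - 1), and the coefficient of X^(n - l) is homogeneous
   of degree l in the entries: it is divisible by t^(l lo) and has degree at most
   l hi. Hence every root has valuation at least lo. If exactly l roots are
   nonzero, then l <= rank (MD) <= n - r, and their product is, up to sign, the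
   coefficient of X^(n - l), of valuation at most l hi. So each slope is at most
   l hi - (l - 1) lo = j + 1 + l (n - 1)(q - 1), which is at most the bound. *)
Require Import Defs.
From HB Require Import structures.
From mathcomp Require Import all_boot all_order all_algebra.
From mathcomp Require Import all_classical all_reals all_analysis.
From mathcomp Require Import perm zify ring.
Import Order.TTheory GRing.Theory Num.Theory.
Local Open Scope classical_set_scope.
Local Open Scope ring_scope.

(** * Characteristic polynomials, similarity and rank *)

Lemma char_poly_intertwine {K : fieldType} {n : nat} (A B Q : 'M[K]_n) :
  Q \in unitmx -> A *m Q = Q *m B -> char_poly A = char_poly B.
Proof.
move=> Qu AQ; pose Q' := map_mx polyC Q.
(* [\det Q'] is a nonzero constant polynomial: multiplying by it and cancelling avoids inverting
   [Q']. *)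
have detQ' : \det Q' != 0.
  by rewrite det_map_mx polyC_eq0 -unitfE -unitmxE.
apply: (mulIf detQ'); rewrite [RHS]mulrC -!det_mulmx; congr (\det _).
rewrite /char_poly_mx mulmxBl mulmxBr -!map_mxM AQ; congr (_ - _).
by rewrite scalar_mxC.
Qed.

(** The rows of [pid_mx k *m G] of index at least [k] vanish, so the same rows of the characteristic
    matrix are those of X times the identity. [d] collects these factors X, and [Y] is what
    remains. *)
Lemma char_poly_pid_mul {K : fieldType} {n : nat} (k : nat) (G : 'M[K]_n) :
  (k <= n)%N -> 'X^(n - k) %| char_poly (pid_mx k *m G).
Proof.
move=> kn; pose d : 'rV[{poly K}]_n := \row_i (if (i < k)%N then 1 else 'X).
pose Y : 'M[{poly K}]_n := \matrix_(i, j)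
  if (i < k)%N then char_poly_mx (pid_mx k *m G) i j else (i == j)%:R.
have -> : char_poly (pid_mx k *m G) = \det (diag_mx d *m Y).
  congr (\det _); apply/matrixP => i j; rewrite mul_diag_mx !mxE.
  case: ifP => ik; first by rewrite mul1r.
  rewrite big1 => [|l _]; last by rewrite !mxE ik andbF mul0r.
  by rewrite subr0 mulr_natr.
rewrite det_mulmx dvdp_mulr // det_diag.
rewrite (eq_bigr (fun i : 'I_n => if ~~ (i < k)%N then 'X else 1)); last first.
  by move=> i _; rewrite mxE; case: ifP.
rewrite -big_mkcond prodr_const /=.
suff -> : #|[pred i : 'I_n | ~~ (i < k)%N]| = (n - k)%N by [].
have ck : #|[pred i : 'I_n | (i < k)%N]| = k.
  by rewrite -sum1_card -(big_ord_widen _ (fun=> 1%N) kn) sum1_card card_ord.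
have := cardC [pred i : 'I_n | (i < k)%N]; rewrite ck card_ord => cC.
by apply: (@addnI k); rewrite subnKC // -[RHS]cC.
Qed.

(** Write A = C E R with C and R invertible and E = [pid_mx (\rank A)]. Conjugating by C turns A
    into E (R C), whose last rows vanish. *)
Lemma dvdp_char_poly_rank {K : fieldType} {n : nat} (A : 'M[K]_n) :
  'X^(n - \rank A) %| char_poly A.
Proof.
have -> : char_poly A =
    char_poly (pid_mx (\rank A) *m (row_ebase A *m col_ebase A)).
  apply: (char_poly_intertwine _ _ (col_ebase A)); first exact: col_ebase_unit.
  by rewrite -{1}[A]mulmx_ebase !mulmxA.
exact/char_poly_pid_mul/rank_leq_row.
Qed.

(** * Matrices with respect to bases of a subspace *)

Section Bases.
Context {K : fieldType} {V : lmodType K}.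

Lemma is_basis_inj {S : set V} {n : nat} {e : 'I_n -> V} (x y : 'I_n -> K) :
  is_basis S e -> \sum_i x i *: e i = \sum_i y i *: e i -> x =1 y.
Proof.
move=> [_ eI] xy i; apply/subr0_eq.
apply: (eI (fun i => x i - y i)).
by under eq_bigr do rewrite scalerBl; rewrite sumrB xy subrr.
Qed.

Lemma is_basis_mem {S : set V} {n : nat} {e : 'I_n -> V} (i : 'I_n) :
  is_basis S e -> S (e i).
Proof.
move=> [eS _]; apply/eS; exists (fun l => (l == i)%:R).
rewrite (bigD1 i) //= eqxx scale1r big1 ?addr0 // => l /negPf ->.
by rewrite scale0r.
Qed.

Lemma is_basis_coord {S : set V} {n m : nat} {e : 'I_n -> V} {f : 'I_m -> V} :
    is_basis S e -> (forall b, S (f b)) ->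
  exists Q : 'M[K]_(n, m), forall b, f b = \sum_a Q a b *: e a.
Proof.
move=> [eS _] fS; have /choice [c fE] b := (eS (f b)).1 (fS b).
by exists (\matrix_(a, b) c b a) => b; under eq_bigr do rewrite mxE.
Qed.

Lemma sum_mul_coord {n m : nat} {e : 'I_n -> V} {f : 'I_m -> V}
    (Q : 'M[K]_(n, m)) (x : 'I_m -> K) :
    (forall b, f b = \sum_a Q a b *: e a) ->
  \sum_b x b *: f b = \sum_a (\sum_b Q a b * x b) *: e a.
Proof.
move=> fE; under eq_bigr do rewrite fE scaler_sumr.
rewrite exchange_big; apply: eq_bigr => a _; rewrite scaler_suml.
by apply: eq_bigr => b _; rewrite scalerA mulrC.
Qed.

Lemma linear_sum_basis {T : V -> V} {n : nat} (x : 'I_n -> K) (e : 'I_n -> V) :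
  linear T -> T (\sum_i x i *: e i) = \sum_i x i *: T (e i).
Proof.
move=> linT; pose Tl : {linear V -> V} :=
  HB.pack T (GRing.isLinear.Build K V V *:%R T linT).
by rewrite -[T]/(Tl : V -> V) linear_sum; under eq_bigr do rewrite linearZ.
Qed.

Lemma is_basis_change_inv {S : set V} {n m : nat} {e : 'I_n -> V}
    {f : 'I_m -> V} {Q : 'M[K]_(n, m)} {Q' : 'M[K]_(m, n)} :
    is_basis S e -> (forall b, f b = \sum_a Q a b *: e a) ->
    (forall b, e b = \sum_a Q' a b *: f a) ->
  Q *m Q' = 1%:M.
Proof.
move=> eB fE eE; apply/matrixP => a b; rewrite !mxE.
apply: (is_basis_inj (fun a => \sum_l Q a l * Q' l b) (fun a => (a == b)%:R) eB).
rewrite -(sum_mul_coord Q (Q' ^~ b) fE) -eE.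
rewrite (bigD1 b) //= eqxx scale1r big1 ?addr0 // => l /negPf ->.
by rewrite scale0r.
Qed.

(** The basis hidden in [is_char_poly] may a priori have another size. The base changes in both
    directions are mutually inverse, which forces equal sizes and makes the two matrices similar. *)
Lemma is_char_poly_basis {S : set V} {T : V -> V} {n : nat} {e : 'I_n -> V}
    {A : 'M[K]_n} {P : {poly K}} :
    linear T -> is_basis S e -> has_matrix T e A -> is_char_poly S T P ->
  P = char_poly A.
Proof.
move=> linT eB eA [m [f [B [fB fM ->]]]].
have [Q fE] := is_basis_coord eB (fun b => is_basis_mem b fB).
have [Q' eE] := is_basis_coord fB (fun b => is_basis_mem b eB).
have QQ' := is_basis_change_inv eB fE eE.
have Q'Q := is_basis_change_inv fB eE fE.
have nm : n = m.
  by apply/eqP; rewrite eqn_leq (mulmx1_min QQ') (mulmx1_min Q'Q).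
case: _ / nm => {m} in f B fB fM Q Q' fE eE QQ' Q'Q *.
have Qu : Q \in unitmx by case: (mulmx1_unit QQ').
symmetry; apply: (char_poly_intertwine _ _ Q Qu); apply/matrixP => a b.
(* Expanding [T (f b)] in the basis [e] in two ways gives Q B = A Q. *)
have : T (f b) = T (f b) by [].
rewrite {1}fM {1}fE (linear_sum_basis (Q ^~ b) e linT).
rewrite (sum_mul_coord Q (B ^~ b) fE) (sum_mul_coord A (Q ^~ b) eA).
by move/(is_basis_inj _ _ eB)/(_ a); rewrite !mxE => ->.
Qed.

(** The coordinates of a basis of the kernel are the columns of a matrix Q with A Q = 0. These
    columns are independent, so Q has rank r. *)
Lemma rank_matrix_ker {S : set V} {T : V -> V} {n r : nat} {e : 'I_n -> V}
    {A : 'M[K]_n} :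
    linear T -> is_basis S e -> has_matrix T e A ->
    has_dim (S `&` [set x | T x = 0]) r ->
  (\rank A + r <= n)%N.
Proof.
move=> linT eB eA [d dB].
have dS b := is_basis_mem b dB.
have [Q dE] := is_basis_coord eB (fun b => (dS b).1).
have AQ0 : A *m Q = 0.
  apply/matrixP => a b; have /= := (dS b).2.
  rewrite dE (linear_sum_basis (Q ^~ b) e linT).
  by rewrite (sum_mul_coord A (Q ^~ b) eA) => /(eB.2 _)/(_ a); rewrite !mxE.
suff rQ : \rank Q = r by have := mulmx0_rank_max AQ0; rewrite rQ.
rewrite -mxrank_tr; apply/eqP/inj_row_free => u uQ; apply/rowP => b.
rewrite mxE; apply: (dB.2 (u 0)); rewrite (sum_mul_coord Q (u 0) dE).
apply: big1 => a _; rewrite -[RHS](scale0r (e a)); congr (_ *: _).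
have /matrixP/(_ 0 a) := uQ; rewrite !mxE => uQa; rewrite -[RHS]uQa.
by apply: eq_bigr => l _; rewrite mxE mulrC.
Qed.

End Bases.

(** [W m] abstracts a condition of weight [m], additive under products. This treats divisibility and
    degree bounds at once. *)
Lemma char_poly_graded {R : comNzRingType} (W : nat -> R -> Prop)
    (W1 : W 0%N 1) (W0 : forall m, W m 0)
    (WB : forall m x y, W m x -> W m y -> W m (x - y))
    (WM : forall l m x y, W l x -> W m y -> W (l + m)%N (x * y))
    {n : nat} (A : 'M[R]_n) :
    (forall i j, W 1%N (A i j)) ->
  forall i, (i <= n)%N -> W (n - i)%N (char_poly A)`_i.
Proof.
move=> WA.
have WN m x : W m x -> W m (- x) by rewrite -[- x]add0r; apply: WB.
have WD m x y : W m x -> W m y -> W m (x + y).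
  by move=> Wx Wy; rewrite -[y]opprK; apply/WB/WN.
(* Homogeneity of total weight [m], the variable X having weight 1. The second clause handles the
   indices where [m - i] would be truncated. *)
pose homog m (P : {poly R}) :=
  (forall i, (i <= m)%N -> W (m - i)%N P`_i) /\
  (forall i, (m < i)%N -> P`_i = 0).
have homogD m P Q : homog m P -> homog m Q -> homog m (P + Q).
  move=> [P1 P2] [Q1 Q2]; split=> i im; rewrite coefD.
    by apply: WD; [exact: P1 | exact: Q1].
  by rewrite P2 ?Q2 ?addr0.
have homogN m P : homog m P -> homog m (- P).
  move=> [P1 P2]; split=> i im; rewrite coefN; first exact/WN/P1.
  by rewrite P2 ?oppr0.
have homogM a b P Q : homog a P -> homog b Q -> homog (a + b)%N (P * Q).
  move=> [P1 P2] [Q1 Q2]; split=> i iab; rewrite coefM; last first.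
    apply: big1 => l _; case: (ltnP a l) => la; first by rewrite P2 ?mul0r.
    have li : (l <= i)%N by rewrite -ltnS.
    rewrite Q2 ?mulr0 // -(ltn_add2l l) subnKC //.
    by apply: leq_trans iab; rewrite ltnS leq_add2r.
  apply: (big_ind (W (a + b - i)%N)) => [//|x y|l _]; first exact: WD.
  case: (ltnP a l) => la; first by rewrite P2 // mul0r.
  case: (ltnP b (i - l)) => lb; first by rewrite Q2 // mulr0.
  have li : (l <= i)%N by rewrite -ltnS.
  have -> : (a + b - i = (a - l) + (b - (i - l)))%N by lia.
  by apply: WM; [exact: P1 | exact: Q1].
suff [] : homog n (char_poly A) by [].
apply: (big_ind (homog n)) => [|P Q|s _]; first by split=> i; rewrite coef0.
  exact: homogD.
suff prodH : homog n (\prod_i char_poly_mx A i (s i)).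
  by case: (odd_perm s); rewrite ?mul1r // expr1 mulN1r; exact: homogN.
(* Writing [n] as a sum of ones lets weights add up along the product: each entry of the
   characteristic matrix has weight 1. *)
have {1}<- : (\sum_(i < n) 1)%N = n by rewrite sum1_card card_ord.
apply: (big_ind2 homog) => [|? ? ? ?|i _]; last 1 first.
- rewrite !mxE; split=> l; rewrite coefB coefMn coefX coefC.
    case: l => [|[|]] //= _; rewrite ?mul0rn ?sub0r ?subr0; first exact/WN.
    by case: (_ == _); rewrite ?mulr0n.
  by case: l => [|[|]] //= l _; rewrite mul0rn subr0.
- split=> l; rewrite coef1 ?leqn0; first by move/eqP->.
  by rewrite lt0n => /negPf ->.
- exact: homogM.
Qed.

(** * Valuations of the roots of a polynomial *)

Section Valuation.
Context {F : finFieldType} {L : closedFieldType}.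
Context {iota : {rmorphism {poly F} -> L}} {v : L -> \bar rat}.
Context (hL : is_Laurent_closure iota v).

Lemma val_eq_pinfty (x : L) : v x = +oo%E <-> x = 0.
Proof. by have [[h _ _] _ _ _] := hL; exact: h. Qed.

Lemma valM (x y : L) : v (x * y) = (v x + v y)%E.
Proof. by have [[_ h _] _ _ _] := hL; exact: h. Qed.

Lemma valD_ge (x y : L) : (Order.min (v x) (v y) <= v (x + y))%E.
Proof. by have [[_ _ h] _ _ _] := hL; exact: h. Qed.

Lemma val_iota (f : {poly F}) : f != 0 -> v (iota f) = (mup 0 f)%:R%:E.
Proof. by have [_ h _ _] := hL; exact: h. Qed.

Lemma val1 : v 1 = 0%E.
Proof.
by rewrite -(rmorph1 iota) val_iota ?oner_neq0 // mupNroot // root1.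
Qed.

Lemma valN (x : L) : v (- x) = v x.
Proof.
rewrite -mulN1r valM -(rmorph1 iota) -rmorphN val_iota ?oppr_eq0 ?oner_neq0 //.
by rewrite mupNroot ?add0e // rootN root1.
Qed.

Lemma val_fin (x : L) : x != 0 -> exists a : rat, v x = a%:E.
Proof.
move=> x0; case E: (v x) => [a||]; first by exists a.
  by move/val_eq_pinfty: E x0 => ->; rewrite eqxx.
(* The value [-oo] is absorbing for addition, so it would propagate to [v 1 = 0]. *)
by have := val1; rewrite -(mulfV x0) valM E.
Qed.

Lemma iota_neq0 (f : {poly F}) : f != 0 -> iota f != 0.
Proof.
by move=> f0; apply/eqP => /val_eq_pinfty; rewrite val_iota.
Qed.

Lemma val_iota_ge (f : {poly F}) (k : nat) :
  'X^k %| f -> ((k%:R : rat)%:E <= v (iota f))%E.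
Proof.
have [->|f0] := eqVneq f 0.
  by rewrite rmorph0 (val_eq_pinfty 0).2 // leey.
by move=> kf; rewrite val_iota // lee_fin ler_nat mup_geq // subr0.
Qed.

Lemma val_iota_le (f : {poly F}) (k : nat) :
  f != 0 -> (size f <= k.+1)%N -> (v (iota f) <= (k%:R : rat)%:E)%E.
Proof.
move=> f0 fk; rewrite val_iota // lee_fin ler_nat -ltnS.
apply: leq_trans fk; have := mup_geq 0 (mup 0 f) f0.
by rewrite leqnn subr0 => /esym/(dvdp_leq f0); rewrite size_polyXn.
Qed.

Lemma valX (x : L) (a : rat) (n : nat) :
  v x = a%:E -> v (x ^+ n) = (a * n%:R)%:E.
Proof.
move=> xa; elim: n => [|n IHn]; first by rewrite expr0 val1 mulr0.
by rewrite exprS valM xa IHn -EFinD -natr1 mulrDr mulr1 addrC.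
Qed.

Lemma val_prod_ge (s : seq L) (f : L -> L) (c : rat) :
    (forall x, x \in s -> (c%:E <= v (f x))%E) ->
  ((c * (size s)%:R)%:E <= v (\prod_(x <- s) f x))%E.
Proof.
elim: s => [|x s IHs] h; first by rewrite big_nil val1 mulr0.
rewrite big_cons valM /= -natr1 mulrDr mulr1 addrC EFinD.
apply: leeD; first by apply: h; rewrite mem_head.
by apply: IHs => y ys; apply: h; rewrite inE ys orbT.
Qed.

Lemma val_sum_gt (n : nat) (f : 'I_n -> L) (c : rat) :
  (forall i, (c%:E < v (f i))%E) -> (c%:E < v (\sum_i f i))%E.
Proof.
move=> h; apply: (big_ind (fun x => c%:E < v x)%E) => [|x y cx cy|i _] //.
  by rewrite (val_eq_pinfty 0).2 // ltry.
by apply: lt_le_trans (valD_ge x y); rewrite lt_min cx.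
Qed.

(** If [v x < c], the leading term of P(x) has strictly smaller valuation than all the others, so
    they cannot cancel it. *)
Lemma val_root_ge (P : {poly L}) (n : nat) (c : rat) (x : L) :
    P \is monic -> size P = n.+1 ->
    (forall i, (i < n)%N -> ((c * (n - i)%:R)%:E <= v P`_i)%E) ->
  root P x -> (c%:E <= v x)%E.
Proof.
move=> /monicP lcP sP hc; rewrite /root horner_coef sP big_ord_recr /=.
have -> : P`_n = 1 by rewrite -lcP lead_coefE sP.
rewrite mul1r addrC addr_eq0 => /eqP Px; rewrite leNgt; apply/negP => xc.
have x0 : x != 0.
  by apply/eqP => /val_eq_pinfty vx; move: xc; rewrite vx.
have [a va] := val_fin x x0; move: xc; rewrite va lte_fin => ac.
have : (v (x ^+ n) < v (x ^+ n))%E; last by rewrite ltxx.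
rewrite {2}Px valN (valX _ a) //; apply: val_sum_gt => i.
have in' := ltn_ord i; rewrite valM (valX _ a) //.
(* The term of index i has valuation at least c (n - i) + a i, which exceeds a n because a < c and i
   < n. *)
apply: lt_le_trans (leeD (hc i in') (lexx _)).
rewrite -EFinD lte_fin -{1}(subnK (ltnW in')) natrD mulrDr ltrD2r.
by rewrite ltr_pM2r // ltr0n subn_gt0.
Qed.

Lemma slope_le (P : {poly {poly F}}) (n lo hi r : nat) (alpha : rat) :
    P \is monic -> size P = n.+1 ->
    (forall i, (i <= n)%N -> 'X^((n - i) * lo) %| P`_i) ->
    (forall i, (i <= n)%N -> (size (P`_i)%R <= ((n - i) * hi).+1)%N) ->
    (forall i, (i < r)%N -> P`_i = 0) ->
    (1 <= slope_mult iota v P alpha)%N ->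
  exists l : nat, [/\ (1 <= l)%N, (l + r <= n)%N &
                      alpha <= (l * hi)%:R - (l.-1 * lo)%:R].
Proof.
move=> Pm sP Plo Phi Pr; rewrite /slope_mult.
case: closed_field_poly_normal => rs /= Prs.
set Q := map_poly iota P in Prs *.
have Qm : Q \is monic by exact: monic_map.
have sQ : size Q = n.+1.
  by rewrite size_map_poly_id0 // (monicP Pm) rmorph1 oner_neq0.
rewrite (monicP Qm) scale1r in Prs.
have srs : size rs = n by have := sQ; rewrite Prs size_prod_XsubC => -[].
rewrite -has_count => /hasP [lam lam_rs /eqP vlam].
have lam0 : lam != 0.
  by apply/eqP => /val_eq_pinfty; rewrite vlam.
have rootsQ x : x \in rs -> (lo%:R%:E <= v x)%E.
  move=> xrs; apply: (val_root_ge Q n) => //; last by rewrite Prs root_prod_XsubC.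
  move=> i /ltnW ile; rewrite coef_map -natrM mulnC.
  exact/val_iota_ge/Plo.
(* The witness is [l = size nz], and [z] is the multiplicity of the root 0. *)
pose nz := [seq x <- rs | x != 0]; pose z := count (pred1 0) rs.
have zn : (size nz + z = n)%N.
  by rewrite size_filter addnC -srs; exact: (count_predC (pred1 0)).
(* Once X^z is factored out, this coefficient is the constant term of the cofactor. *)
have Qz : Q`_z = \prod_(x <- nz) (- x).
  rewrite Prs (bigID (pred1 0)) /=.
  have -> : \prod_(x <- rs | x == 0) ('X - x%:P) = 'X^z.
    rewrite (eq_bigr (fun=> 'X)) => [|x /eqP ->]; last by rewrite subr0.
    by rewrite big_const_seq iter_mulr mulr1.
  rewrite coefXnM ltnn subnn -big_filter -horner_coef0 horner_prod.
  by apply: eq_bigr => x _; rewrite hornerXsubC sub0r.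
have Qz0 : Q`_z != 0.
  rewrite Qz prodf_seq_neq0; apply/allP => x; rewrite mem_filter oppr_eq0.
  by case/andP.
have Pz0 : P`_z != 0.
  by apply: contraNneq Qz0 => Pz; rewrite coef_map /= Pz rmorph0.
have lam_nz : lam \in nz by rewrite mem_filter lam0.
have nz_gt0 : (0 < size nz)%N by case: (nz) lam_nz.
exists (size nz); split=> //.
  (* The coefficients below [r] vanish and that of index [z] does not, hence [r <= z]. *)
  by rewrite -zn leq_add2l leqNgt; apply: contra Pz0 => /Pr ->.
have := val_iota_le P`_z (size nz * hi) Pz0.
have nzE : (size nz = n - z)%N by rewrite -zn addnK.
rewrite {1}nzE.
have {}zn : (z <= n)%N by rewrite -zn leq_addl.
move=> /(_ (Phi _ zn)); rewrite -coef_map -/Q Qz (big_rem lam) //= valM valN vlam.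
(* [rem] deletes a single occurrence of [lam], so [l.-1] roots remain, counted with multiplicity. *)
have : forall x, x \in rem lam nz -> (lo%:R%:E <= v (- x))%E.
  move=> x /mem_rem; rewrite mem_filter valN => /andP [_]; exact: rootsQ.
move=> /val_prod_ge; rewrite size_rem // => h.
move/(le_trans (leeD (lexx _) h)); rewrite -EFinD lee_fin lerBrDr.
by rewrite -natrM (mulnC lo).
Qed.
End Valuation.

(** * Application to the Atkin operator *)

Lemma Ut_linear {F : finFieldType} {C : closedFieldType}
  (iota : {rmorphism {poly F} -> C}) : linear (Ut iota).
Proof.
by move=> a f g; apply/funext => z; rewrite /Ut !fctE scaler_sumr -big_split.
Qed.

Lemma iota_Cinfty_inj {R : realType} {F : finFieldType} {C : closedFieldType}
    {iota : {rmorphism {poly F} -> C}} {abs : C -> R} :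
  is_Cinfty iota abs -> injective iota.
Proof.
move=> [[_ abs0 _ _] absE _ _]; apply: raddf_inj => f f0.
apply/eqP/negPn/negP => /absE; rewrite f0 (abs0 0).2 // => /esym/eqP.
rewrite expf_eq0 pnatr_eq0 => /andP [_ /eqP F0].
by have := card_finNzRing_gt1 F; rewrite F0.
Qed.

Lemma char_poly_MDmx_bounds {F : finFieldType} (j n i : nat) : (i <= n)%N ->
  'X^((n - i) * j.+1) %| (char_poly (MDmx F j n))`_i /\
  (size ((char_poly (MDmx F j n))`_i)%R
     <= ((n - i) * (j.+1 + (n - 1) * (#|F| - 1))).+1)%N.
Proof.
set hi := (j.+1 + _)%N.
(* All monomials of f have degree between m (j + 1) and m [hi]. *)
pose W m (f : {poly F}) := 'X^(m * j.+1) %| f /\ (size f <= (m * hi).+1)%N.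
move: i; apply: (char_poly_graded W) => [|m|m f g|l m f g|a b].
- by split; rewrite ?expr0 ?dvd1p // size_poly1.
- by split; rewrite ?dvdp0 // size_poly0.
- move=> [fX fs] [gX gs]; split; first exact: dvdp_sub.
  by apply: leq_trans (size_polyD _ _) _; rewrite size_polyN geq_max fs.
- move=> [fX fs] [gX gs]; split; first by rewrite mulnDl exprD dvdp_mul.
  apply: leq_trans (size_polyMleq _ _) _; rewrite mulnDl; lia.
- have -> : MDmx F j n a b = (Mmx F j n a b)%:P * 'X^(j.+1 + b * (#|F| - 1)).
    by rewrite /MDmx /Dmx mul_mx_diag !mxE.
  rewrite /W !mul1n; split; first by rewrite exprD mulrA dvdp_mulr ?dvdp_mull.
  apply: leq_trans (size_polyMleq _ _) _; rewrite size_polyXn size_polyC.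
  have : (j.+1 + b * (#|F| - 1) <= hi)%N.
    by rewrite leq_add2l leq_mul2r; have := ltn_ord b; lia.
  (* The entry of [Mmx] may vanish, and then its constant polynomial has size 0 instead of 1. *)
  by case: (_ == _) => /=; lia.
Qed.

Theorem theorem6p4
  (p e q : nat) (hp : prime p) (he : (0 < e)%N) (hq : q = (p ^ e)%N)
  (F : finFieldType) (hF : #|F| = q)
  (* C_oo *)
  (R : realType) (C : closedFieldType) (iota : {rmorphism {poly F} -> C})
  (abs : C -> R) (hC : is_Cinfty iota abs)
  (* the algebraic closure of F_q((t)) with its t-adic valuation *)
  (L : closedFieldType) (iotaL : {rmorphism {poly F} -> L})
  (v : L -> \bar rat) (hL : is_Laurent_closure iotaL v)
  (j n k : nat) (m : int)
  (hj : (j <= q - 2)%N) (hn : (1 <= n)%N)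
  (hk : k = (2 * j + 2 + (n - 1) * (q - 1))%N)
  (hm : (m = j.+1%:Z %[mod (q - 1)%N%:Z])%Z)
  (r : nat) (hr : has_dim (cusp_forms iota abs k m (@GL2A F)) r)
  (* known: Ker U_t has the dimension of the space of level 1 *)
  (hker : forall d, has_dim (cusp_forms iota abs k m (@GL2A F)) d ->
      has_dim (cusp_forms iota abs k m (@Gamma0t F)
                 `&` [set phi | Ut iota phi = 0]) d)
  (* known: the matrix of U_t *)
  (hMD : exists c : 'I_n -> (C -> C^o),
      is_basis (cusp_forms iota abs k m (@Gamma0t F)) c /\
      has_matrix (Ut iota) c (map_mx iota (MDmx F j n)))
  (P : {poly {poly F}})
  (hP : is_char_poly (cusp_forms iota abs k m (@Gamma0t F)) (Ut iota)
          (map_poly iota P))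
  (alpha : rat) (halpha : (1 <= slope_mult iotaL v P alpha)%N) :
  alpha <= j%:R + 1 + ((n%:R - r%:R) * n%:R - 1) * (q%:R - 1).
Proof.
have [c [cB cM]] := hMD; have linU := Ut_linear iota.
have iotaI := iota_Cinfty_inj hC.
(* [hP] only determines the image of [P] over [C]; injectivity of [iota] brings the equality back to
   [{poly F}]. *)
have PE : P = char_poly (MDmx F j n).
  apply: (map_inj_poly iotaI (rmorph0 _)).
  by rewrite (is_char_poly_basis linU cB cM hP) -map_char_poly.
have rk := rank_matrix_ker linU cB cM (hker r hr).
have P0 i : (i < r)%N -> P`_i = 0.
  move=> ir; apply: iotaI; rewrite rmorph0 -coef_map PE map_char_poly.
  have /dvdpP [Q ->] := dvdp_char_poly_rank (map_mx iota (MDmx F j n)).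
  by rewrite coefMXn ltn_subRL (leq_trans _ rk) // ltn_add2l.
have [||||l [l1 lr al]] := slope_le hL P n j.+1
    (j.+1 + (n - 1) * (#|F| - 1))%N r alpha _ _ _ _ P0 halpha.
- by rewrite PE char_poly_monic.
- by rewrite PE size_char_poly.
- by move=> i ile; rewrite PE; exact: (char_poly_MDmx_bounds j n i ile).1.
- by move=> i ile; rewrite PE; exact: (char_poly_MDmx_bounds j n i ile).2.
apply: (le_trans al); rewrite hF.
have q_gt0 : (0 < q)%N by rewrite hq expn_gt0 prime_gt0.
(* With [n] and [q] written as successors, the truncated subtractions become exact in the
   rationals. *)
rewrite -(prednK q_gt0) -(prednK hn) !subn1 /=.
(* From here on there are [l.+1] nonzero roots, and [s] is the slack in the rank inequality. The
   bound exceeds the estimate by exactly (q - 1)(s n + l), which is nonnegative. *)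
case: l l1 lr {al} => // l _ lr; pose s := (n - (l.+1 + r))%N.
have nE : n.-1.+1 = (l.+1 + r + s)%N by rewrite prednK // subnKC.
rewrite -subr_ge0.
have -> : j%:R + 1 + ((n.-1.+1%:R - r%:R) * n.-1.+1%:R - 1) * (q.-1.+1%:R - 1)
    - ((l.+1 * (j.+1 + n.-1 * q.-1))%:R - (l * j.+1)%:R)
    = (q.-1 * (s * n.-1.+1 + l))%:R :> rat.
  have : n.-1%:R = l%:R + r%:R + s%:R :> rat.
    by rewrite -!natrD; congr _%:R; lia.
  rewrite !(natrM, natrD, mulrS) => ->; ring.
exact: ler0n.
Qed.
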